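(* Let $d \ge 1$ and $1 \le r \le d$ be integers, and let $B_1, B_2, \dots, B_r$ be a set of $r$ mutually unbiased bases of $\mathbb{C}^d$, each of whose vectors has all entries of unit magnitude. Regard each $B_j$ as an ordered set of $d$ vectors (the ordering being fixed once and for all). Let $t \ge 1$ be an integer and let $a_1, a_2, \dots, a_t \in \mathbb{C}$ be constants. For $v \in \mathbb{C}$ and $1 \le j \le r$, let $B_j(v)$ be the ordered set of $d$ vectors obtained by multiplying entry $j$ of each vector of $B_j$ by $v$ (keeping the ordering of $B_j$), and let $L(v) = B_1(v) \cup B_2(v) \cup \dots \cup B_r(v)$, considered as an ordered list of $rd$ vectors in $\mathbb{C}^d$ (first the vectors of $B_1(v)$ in order, then those of $B_2(v)$, and so on). Put $a_{t+1} = t+1-\sum_{j=1}^t a_j$. For $1 \le i \le rd$, let $\mathbf{w}_i \in \mathbb{C}^{(t+1)d}$ be the concatenation of the $i$-th vector of $L(a_1)$, the $i$-th vector of $L(a_2)$, $\dots$, the $i$-th vector of $L(a_t)$, and the $i$-th vector of $L(a_{t+1})$ (i.e. the $rd$ rows of the $rd \times (t+1)d$ matrix $[\,L(a_1)\ L(a_2)\ \cdots\ L(a_t)\ L(a_{t+1})\,]$). Then for all $i \neq i'$, the Hermitian inner product $\langle \mathbf{w}_i, \mathbf{w}_{i'}\rangle$ has magnitude either $$\sum_{j=1}^t |a_j - 1|^2 + \Big|\sum_{j=1}^t (a_j - 1)\Big|^2 \quad\text{or}\quad (t+1)\sqrt{d}.$$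
   Context: $\langle \mathbf{x}, \mathbf{y}\rangle = \sum_\ell x_\ell \overline{y_\ell}$ is the standard Hermitian inner product on $\mathbb{C}^n$. Two orthogonal bases $\{\mathbf{x}_1,\dots,\mathbf{x}_d\}$ and $\{\mathbf{y}_1,\dots,\mathbf{y}_d\}$ of $\mathbb{C}^d$ are unbiased if $|\langle \mathbf{x}_j, \mathbf{y}_k\rangle| / (\|\mathbf{x}_j\|\,\|\mathbf{y}_k\|) = 1/\sqrt{d}$ for all $j,k$. A set of orthogonal bases is a set of mutually unbiased bases (MUBs) if every pair of distinct bases in it is unbiased. An ordered set of $m$ vectors in $\mathbb{C}^d$ is identified with the $m \times d$ matrix whose rows are these vectors in order. *)

(* Defs.v *)
From HB Require Import structures.
From mathcomp Require Import all_boot all_order all_algebra.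
From mathcomp Require Import complex.
From mathcomp Require Import reals.

Set Implicit Arguments.
Unset Strict Implicit.
Unset Printing Implicit Defensive.

Import Order.TTheory GRing.Theory Num.Theory.
Local Open Scope ring_scope.

Section MUB.
Variable C : numClosedFieldType.

(* [dotmx x y] is \sum_l x_l * (y_l)^*, conjugate-linear in its second
   argument; an ordered set of m vectors of C^n is the matrix of its rows. *)

Definition hnorm n (x : 'rV[C]_n) : C := sqrtC (dotmx x x).

Definition orthogonal_basis d (B : 'M[C]_d) : Prop :=
  basis_of {:'rV[C]_d}%VS [seq row i B | i : 'I_d] /\
  forall i k : 'I_d, i != k -> dotmx (row i B) (row k B) = 0.

Definition unbiased d (A B : 'M[C]_d) : Prop :=
  forall j k : 'I_d,
    `|dotmx (row j A) (row k B)| / (hnorm (row j A) * hnorm (row k B))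
      = 1 / sqrtC d%:R.

Definition mutually_unbiased_bases d r (B : 'I_r -> 'M[C]_d) : Prop :=
  (forall j, orthogonal_basis (B j)) /\
  (forall j k, j != k -> unbiased (B j) (B k)).

(* [l == j :> nat] selects the entry with the same position as the basis; no
   entry is scaled when d <= j, so this is meaningful for r <= d only. *)
Definition scaled_basis d r (B : 'I_r -> 'M[C]_d) (j : 'I_r) (v : C) : 'M[C]_d :=
  \matrix_(k, l) (if l == j :> nat then v * B j k l else B j k l).

Definition stacked_bases d r (B : 'I_r -> 'M[C]_d) (v : C) :
    'M[C]_(\sum_(j < r) d, d) :=
  \mxcol_(j < r) scaled_basis B j v.

Definition extended_constants t (a : 'I_t -> C) (k : 'I_t.+1) : C :=
  if unlift ord_max k is Some j then a j else t.+1%:R - \sum_(j < t) a j.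

Definition concatenated_stacks d r t (B : 'I_r -> 'M[C]_d) (a : 'I_t -> C) :
    'M[C]_(\sum_(j < r) d, \sum_(k < t.+1) d) :=
  \mxrow_(k < t.+1) stacked_bases B (extended_constants a k).

End MUB.

(* Main.v *)
(** Let [c_1, ..., c_(t+1)] be the constants; they sum to [t+1].  Scaling only
    touches one entry of each vector.  For two vectors [x, y] of the same basis
    [B_j], the block of constant [c_s] contributes
    [<x, y> + (|c_s|^2 - 1) x_j (y_j)^*] with [<x, y> = 0], and
    [\sum_s (|c_s|^2 - 1) = \sum_s |c_s - 1|^2] because the [c_s] average to
    [1].  For vectors of distinct bases [B_j], [B_j'] the corrections are linear
    in [c_s - 1] and its conjugate, so they cancel in the sum over [s], which
    leaves [(t+1) <x, y>], of modulus [(t+1) sqrt d] by unbiasedness. *)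
Require Import Defs.
From HB Require Import structures.
From mathcomp Require Import all_boot all_order all_algebra.
From mathcomp Require Import complex.
From mathcomp Require Import reals.
From mathcomp Require Import ring.

Import Order.TTheory GRing.Theory Num.Theory.
Local Open Scope ring_scope.

Section UnimodularUnbiasedBases.
Variable C : numClosedFieldType.

Lemma dotmx_sum n (u v : 'rV[C]_n) : dotmx u v = \sum_l u 0 l * (v 0 l)^*.
Proof. by rewrite dotmxE mxE; apply: eq_bigr => l _; rewrite !mxE. Qed.

Lemma dotmx_row_mxrow m n p (A : 'I_p -> 'M[C]_(m, n)) (i i' : 'I_m) :
  dotmx (row i (\mxrow_(k < p) A k)) (row i' (\mxrow_(k < p) A k))
    = \sum_(k < p) dotmx (row i (A k)) (row i' (A k)).
Proof.
rewrite dotmxE !row_mxrow.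
set v := (X in _ *m X); have -> : v = \mxcol_k (row i' (A k) ^t*)%sesqui.
  by apply/matrixP => l m'; rewrite !mxE.
by rewrite mul_mxrow_mxcol summxE; apply: eq_bigr => k _; rewrite dotmxE.
Qed.

Lemma stacked_bases_Rank d r (B : 'I_r -> 'M[C]_d) v j k :
  row (tagnat.Rank j k) (stacked_bases B v) = row k (scaled_basis B j v).
Proof.
apply/rowP => l; rewrite /stacked_bases.
rewrite -(mxcolK (fun j => scaled_basis B j v) j).
by rewrite !mxE.
Qed.

(** Kept general in [f] to serve twice: with the identity, and with the squared distance to 1. *)
Lemma sum_extended_constants t (a : 'I_t -> C) (f : C -> C) :
  \sum_k f (extended_constants a k)
    = \sum_(j < t) f (a j) + f (t.+1%:R - \sum_(j < t) a j).
Proof.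
rewrite big_ord_recr /= {2}/extended_constants unlift_none; congr (_ + _).
apply: eq_bigr => j _; rewrite /extended_constants.
suff -> : widen_ord (leqnSn t) j = lift ord_max j by rewrite liftK.
by apply: val_inj; rewrite /= /bump leqNgt ltn_ord.
Qed.

Lemma sum_extended_constants_id t (a : 'I_t -> C) :
  \sum_k extended_constants a k = t.+1%:R.
Proof. by rewrite (sum_extended_constants _ a id) addrC subrK. Qed.

(** Expand [|c - 1|^2 = |c|^2 - c - c^* + 1]: the constants, and likewise their conjugates, sum to
    [t+1], which leaves the sum of [|c|^2 - 1]. *)
Lemma sum_extended_constants_normsq t (a : 'I_t -> C) :
  \sum_k (`|extended_constants a k| ^+ 2 - 1)
    = \sum_(j < t) `|a j - 1| ^+ 2 + `|\sum_(j < t) (a j - 1)| ^+ 2.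
Proof.
(* The last constant minus 1 is the opposite of the sum of the [a j - 1], so the second term is its
   share of the sum. *)
have -> : `|\sum_(j < t) (a j - 1)| = `|t.+1%:R - (\sum_(j < t) a j) - 1|.
  rewrite sumrB sumr_const card_ord -normrN opprB -natr1.
  by congr `|_|; ring.
rewrite -(sum_extended_constants _ a (fun z => `|z - 1| ^+ 2)).
have S := sum_extended_constants_id _ a.
under [RHS]eq_bigr => k _ do
  rewrite normCK rmorphB rmorph1 mulrBr mulr1 mulrBl mul1r -normCK opprB addrA.
rewrite !big_split /= !sumrN -rmorph_sum S sumr_const card_ord.
by rewrite rmorph_nat; ring.
Qed.

Section ScaledDot.
Variables (d r : nat) (B : 'I_r -> 'M[C]_d).
Hypothesis le_rd : (r <= d)%N.

Lemma dotmx_scaled_same (j : 'I_r) (k k' : 'I_d) v (l := widen_ord le_rd j) :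
  dotmx (row k (scaled_basis B j v)) (row k' (scaled_basis B j v))
    = dotmx (row k (B j)) (row k' (B j))
      + (`|v| ^+ 2 - 1) * (B j k l * (B j k' l)^*).
Proof.
rewrite !dotmx_sum (bigD1 l) //= [in RHS](bigD1 l) //= !mxE eqxx.
under eq_bigr => m ne_ml do rewrite !mxE (negbTE (ne_ml : m != j :> nat)).
under [in RHS]eq_bigr => m _ do rewrite !mxE.
by rewrite normCK rmorphM; ring.
Qed.

(** The scaled columns [l] and [l'] are distinct: at [l] only the left vector gains the factor [v],
    at [l'] only the right one, whence [v^*]. No [|v|^2] arises. *)
Lemma dotmx_scaled_diff (j j' : 'I_r) (k k' : 'I_d) v
    (l := widen_ord le_rd j) (l' := widen_ord le_rd j') : j != j' ->
  dotmx (row k (scaled_basis B j v)) (row k' (scaled_basis B j' v))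
    = dotmx (row k (B j)) (row k' (B j'))
      + (v - 1) * (B j k l * (B j' k' l)^*)
      + (v - 1)^* * (B j k l' * (B j' k' l')^*).
Proof.
move=> ne_jj'; have ne_ll' : l' != l by rewrite eq_sym.
rewrite !dotmx_sum (bigD1 l) //= [in RHS](bigD1 l) //=.
rewrite (bigD1 l') //= [in RHS](bigD1 l') //= !mxE !eqxx.
rewrite !(negbTE (ne_jj' : j != j' :> nat)) !(negbTE (ne_ll' : j' != j :> nat)).
under eq_bigr => m /andP[ne_ml ne_ml'] do
  rewrite !mxE (negbTE (ne_ml : m != j :> nat))
          (negbTE (ne_ml' : m != j' :> nat)).
under [in RHS]eq_bigr => m _ do rewrite !mxE.
by rewrite rmorphM rmorphB rmorph1; ring.
Qed.

End ScaledDot.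

Lemma hnorm_unimodular n (u : 'rV[C]_n) :
  (forall l, `|u 0 l| = 1) -> hnorm u = sqrtC n%:R.
Proof.
move=> u1; rewrite /hnorm dotmx_sum; congr sqrtC.
under eq_bigr do rewrite -normCK u1 expr1n.
by rewrite sumr_const card_ord.
Qed.

Lemma unbiased_unimodular d (A B : 'M[C]_d) (k k' : 'I_d) :
  (forall i j, `|A i j| = 1) -> (forall i j, `|B i j| = 1) ->
  unbiased A B -> `|dotmx (row k A) (row k' B)| = sqrtC d%:R.
Proof.
move=> A1 B1 /(_ k k'); rewrite !hnorm_unimodular; try by move=> l; rewrite mxE.
have d0 : sqrtC (d%:R : C) != 0.
  by rewrite sqrtC_eq0 pnatr_eq0 -lt0n (leq_ltn_trans _ (ltn_ord k)).
move/(congr1 (fun x => x * (sqrtC d%:R * sqrtC d%:R))).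
by rewrite divfK ?mulf_neq0 // div1r mulKf.
Qed.

Lemma dotmx_concatenated_stacks d r t (B : 'I_r -> 'M[C]_d) (a : 'I_t -> C)
    j j' k k' :
  dotmx (row (tagnat.Rank j k) (concatenated_stacks B a))
        (row (tagnat.Rank j' k') (concatenated_stacks B a))
    = \sum_s dotmx (row k (scaled_basis B j (extended_constants a s)))
                   (row k' (scaled_basis B j' (extended_constants a s))).
Proof.
by rewrite dotmx_row_mxrow; apply: eq_bigr => s _; rewrite !stacked_bases_Rank.
Qed.

End UnimodularUnbiasedBases.

Theorem theorem2p1 (R : realType) (d r t : nat)
    (hd : (1 <= d)%N) (hr : (1 <= r <= d)%N) (ht : (1 <= t)%N)
    (B : 'I_r -> 'M[R[i]]_d)
    (hB : mutually_unbiased_bases B)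
    (hunit : forall (j : 'I_r) (k l : 'I_d), `|B j k l| = 1)
    (a : 'I_t -> R[i])
    (i i' : 'I_(\sum_(j < r) d)) (hii' : i != i') :
  let w := fun k => row k (concatenated_stacks B a) in
  `|dotmx (w i) (w i')| =
      \sum_(j < t) `|a j - 1| ^+ 2 + `|\sum_(j < t) (a j - 1)| ^+ 2
  \/ `|dotmx (w i) (w i')| = t.+1%:R * sqrtC d%:R.
Proof.
move=> w; rewrite {}/w; have [_ le_rd] := andP hr; case: hB => orthoB unbB.
(* Split each flat index into a basis and a position in that basis. *)
rewrite -(tagnat.sig2K i) -(tagnat.sig2K i') in hii' *.
move: (tagnat.sig1 i) (tagnat.sig2 i) (tagnat.sig1 i') (tagnat.sig2 i') hii'.
move=> {i i'} j k j' k' ne; rewrite !dotmx_concatenated_stacks.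
have [ejj'|ne_jj'] := eqVneq j j'; [left|right].
  case: _ / ejj' k' ne => k' ne.
  have ne_kk' : k != k' by apply: contraNneq ne => ->.
  under eq_bigr do
    rewrite (dotmx_scaled_same _ _ _ _ le_rd) (orthoB j).2 // add0r.
  (* The common factor is a product of two entries of modulus 1; the remaining sum is nonnegative,
     hence its own modulus. *)
  rewrite -mulr_suml sum_extended_constants_normsq !normrM norm_conjC !hunit.
  rewrite !mulr1 ger0_norm // addr_ge0 ?exprn_ge0 // sumr_ge0 // => s _.
  exact: exprn_ge0.
under eq_bigr do rewrite (dotmx_scaled_diff _ _ _ _ le_rd) //.
(* Both corrections carry the factor [(t+1) - (t+1)] or its conjugate, so they vanish. *)
rewrite !big_split /= -!mulr_suml -rmorph_sum sumrB sum_extended_constants_id.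
rewrite !sumr_const card_ord subrr rmorph0 !mul0r !addr0.
rewrite -[X in `|X|]mulr_natl normrM normr_nat unbiased_unimodular //.
exact: unbB.
Qed.
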